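(* Assume $\operatorname{add}(\mathcal N)=\operatorname{cov}(\mathcal N)$. Then $\mathcal{AN}_{\operatorname{add}(\mathcal N)}$ is strongly $2^{\mathfrak c}$-algebrable in $\left(\mathbb R^{\mathbb R}\right)^{\operatorname{add}(\mathcal N)}$.
   Context: For a regular infinite cardinal $\kappa$, a $\kappa$-sequence $(x_\alpha)_{\alpha<\kappa}$ converges to $x$ if for every neighbourhood $U$ of $x$ there is $\alpha_0<\kappa$ with $x_\alpha\in U$ for all $\alpha_0<\alpha<\kappa$; $\left(\mathbb R^{\mathbb R}\right)^{\kappa}$ is the commutative real algebra of $\kappa$-sequences of functions $\mathbb R\to\mathbb R$ with indexwise operations. $\operatorname{add}(\mathcal N)$ is the least cardinality of a family of Lebesgue null sets with non-null union; $\operatorname{cov}(\mathcal N)$ the least cardinality of a family of null sets covering $[0,1]$. $\mathcal{AN}_{\kappa}$: $\kappa$-sequences of Lebesgue measurable functions $f_\alpha:\mathbb R\to\mathbb R$ converging pointwise a.e. to a function that is not Lebesgue measurable. $S$ is strongly $\mu$-algebrable if there is a set $X$ of $\mu$ algebraically independent elements such that every nonzero element of the (non-unital) algebra generated by $X$ belongs to $S$. *)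

(* Defs.v *)
From HB Require Import structures.
From mathcomp Require Import all_boot all_order all_algebra.
From mathcomp Require Import mpoly.
From mathcomp Require Import all_classical all_reals all_analysis.
Set Implicit Arguments. Unset Strict Implicit. Unset Printing Implicit Defensive.
Import Order.TTheory GRing.Theory Num.Theory.
Import numFieldNormedType.Exports.
Local Open Scope classical_set_scope.
Local Open Scope ring_scope.

Section Defs.
Context {R : realType}.

Definition lnull (A : set R) : Prop :=
  (@lebesgue_measure R).-negligible (A : set (measurableTypeR R)).

(* Lebesgue measurable sets: completion of the Borel sets w.r.t. Lebesgue
   measure, i.e. sets of the form B \/ N with B Borel and N Lebesgue-null. *)
Definition lmeasurable_set (A : set R) : Prop :=
  exists B N : set R, measurable (B : set (measurableTypeR R)) /\ lnull N /\
    A = B `|` N.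

Definition lmeasurable_fun (f : R -> R) : Prop :=
  forall B : set R, measurable (B : set (measurableTypeR R)) ->
    lmeasurable_set (f @^-1` B).

(* A subset S of an index type has cardinality < add(N):
   every family of null sets indexed by S has a null union. *)
Definition below_addN (I : Type) (S : set I) : Prop :=
  forall F : I -> set R, (forall i, S i -> lnull (F i)) ->
    lnull (\bigcup_(i in S) F i).

Definition strict_wellorder (I : Type) (lt : I -> I -> Prop) : Prop :=
  [/\ (forall i, ~ lt i i),
      (forall i j k, lt i j -> lt j k -> lt i k),
      (forall i j, [\/ lt i j, i = j | lt j i]) &
      well_founded lt].

(* (I, lt) is (order-isomorphic to) the initial ordinal add(N):
   a well-order all of whose proper initial segments have cardinality
   < add(N), while I itself has cardinality >= add(N). *)
Definition is_addN_ordinal (I : Type) (lt : I -> I -> Prop) : Prop :=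
  [/\ strict_wellorder lt,
      (forall i, below_addN [set j | lt j i]) &
      ~ below_addN [set: I]].

(* cov(N) <= |I| : some family of null sets indexed by I covers [0,1] *)
Definition covers01 (I : Type) : Prop :=
  exists F : I -> set R, (forall i, lnull (F i)) /\
    [set x : R | 0 <= x <= 1] `<=` \bigcup_i F i.

Definition kconverges (I : Type) (lt : I -> I -> Prop) (a : I -> R) (l : R)
  : Prop :=
  forall U : set R, nbhs l U -> exists i0, forall i, lt i0 i -> U (a i).

Definition AN (I : Type) (lt : I -> I -> Prop) (f : I -> R -> R) : Prop :=
  (forall i, lmeasurable_fun (f i)) /\
  exists g : R -> R, ~ lmeasurable_fun g /\
    exists N : set R, lnull N /\
      forall t, ~ N t -> kconverges lt (fun i => f i t) (g t).

Definition peval (I : Type) (n : nat) (P : mpoly.mpoly n R)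
  (x : 'I_n -> I -> R -> R) : I -> R -> R :=
  fun i t => mpoly.meval (fun k => x k i t) P.

Definition strongly_algebrable (I : Type) (U : Type) (Card : set U)
  (S : (I -> R -> R) -> Prop) : Prop :=
  exists X : set (I -> R -> R), (X #= Card)%card /\
    forall (n : nat) (x : 'I_n -> I -> R -> R), injective x ->
      (forall k, X (x k)) ->
      forall P : mpoly.mpoly n R, P != 0 ->
        peval P x <> (fun _ _ => 0) /\
        (* nonzero elements of the generated (non-unital) algebra lie in S *)
        (mpoly.meval (fun _ => 0) P = 0 -> S (peval P x)).

End Defs.

(* Main.v *)
Require Import Defs.
From HB Require Import structures.
From mathcomp Require Import all_boot all_order all_algebra.
From mathcomp Require Import mpoly.
From mathcomp Require Import wochoice all_classical all_reals all_analysis.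
From mathcomp Require Import lra.
Import Order.TTheory GRing.Theory Num.Theory.
Import numFieldNormedType.Exports.
Local Open Scope classical_set_scope.
Local Open Scope ring_scope.

(* Since add(N) = cov(N), the interval [0,1] is an increasing union of null sets
   M_i indexed by the ordinal add(N).  For any g : R -> R the functions
   g 1_(M_i) vanish almost everywhere, and at each point of [0,1] they are
   eventually equal to g.  A polynomial P without constant term commutes with
   g |-> g 1_(M_i), so it is enough to find 2^c functions h_A (A a set of reals)
   such that P(h_A1, ..., h_An) is never measurable on [0,1].  A transfinite
   recursion of Bernstein type splits R into continuum many pieces, each meeting
   every closed subset of [0,1] of positive measure; composing the projection to
   the index of the piece with a Fichtenholz-Kantorovich independent family
   makes (h_A1, ..., h_An) take every value in R^n on each such closed set. *)

(** * Transfinite selection of distinct points *)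

(* A well-order of J of least possible order type, i.e. the cardinal of J. *)
Lemma initial_well_order (J : Type) : exists lt : J -> J -> Prop,
  [/\ well_founded lt, forall a b, a <> b -> lt a b \/ lt b a &
      forall a, ~ exists e : J -> J, injective e /\ forall j, lt (e j) a].
Proof.
have [R woR] := @well_ordering_principle {classic J}.
pose sl (a b : J) := R a b /\ a <> b.
have minP (P : J -> Prop) : (exists x, P x) ->
    exists2 z, P z & (forall y, P y -> R z y) /\
      forall z', P z' -> (forall y, P y -> R z' y) -> z = z'.
  move=> [x Px]; have PE y : (y \in [pred y | `[<P y>]]) = `[<P y>] by [].
  have [|z [[zin zlb] zu]] := woR [pred y | `[<P y>]].
    by exists x; rewrite PE; apply/asboolP.
  exists z; first by move: zin; rewrite PE => /asboolP.
  split=> [y Py|z' Pz' z'lb]; first by apply: zlb; rewrite PE; apply/asboolP.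
  apply: zu; split; first by rewrite PE; apply/asboolP.
  by move=> y; rewrite PE => /asboolP; apply: z'lb.
have Rtot a b : R a b \/ R b a.
  have [|z zab [zmin _]] := minP (fun x => x = a \/ x = b); first by exists a; left.
  by case: zab => ez; subst z; [left|right]; apply: zmin; [right|left].
have Rrefl a : R a a by case: (Rtot a a).
have Ranti a b : R a b -> R b a -> a = b.
  move=> Rab Rba.
  have [|z _ [_ zu]] := minP (fun x => x = a \/ x = b); first by exists a; left.
  transitivity z; [symmetry|]; apply: zu; auto; by move=> _ [] ->.
have slwf : well_founded sl.
  move=> a; apply: contrapT => na.
  have [|z nz [zmin _]] := minP (fun x => ~ Acc sl x); first by exists a.
  apply: nz; constructor => y [Ryz yz]; apply: contrapT => ny.
  by apply: yz; apply: Ranti => //; apply: zmin.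
have sltot a b : a <> b -> sl a b \/ sl b a.
  move=> ab; case: (Rtot a b) => H; [left|right]; split=> //.
  by move=> ba; apply: ab.
pose bad a := exists e : J -> J, injective e /\ forall j, sl (e j) a.
have [exbad|nobad] := pselect (exists a, bad a); last first.
  by exists sl; split=> // a ba; apply: nobad; exists a.
have [a [e [einj ea]] [amin _]] := minP bad exbad.
(* Pull the order back along an embedding [e] of [J] below the least bad [a]: if some [j] were bad
   for the new order, [e j] would be bad for [sl] and lie below [a]. *)
exists (fun j k => sl (e j) (e k)); split.
- have: forall x, forall j, e j = x -> Acc (fun j k => sl (e j) (e k)) j.
    move=> x; elim: (slwf x) => {}x _ IH j ej; constructor => k ekj.
    by apply: (IH (e k)) => //; rewrite -ej.
  by move=> H j; apply: (H (e j)).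
- by move=> j k jk; apply: sltot => /einj.
- move=> j [i [iinj ij]]; have [Rja ja] := ea j.
  apply: ja; apply: Ranti => //; apply: amin.
  by exists (e \o i); split=> // x y /= /einj /iinj.
Qed.

(* Transfinite recursion: fewer than |J| values are used at each stage. *)
Lemma injective_transversal (J T : Type) (E : J -> J -> T) :
  (forall j, injective (E j)) ->
  exists p : J -> T, injective p /\ forall j, exists k, p j = E j k.
Proof.
move=> Einj; have [lt [ltwf lttot ltsmall]] := initial_well_order J.
have step j (q : forall k, lt k j -> T) :
    exists x, forall k (h : lt k j), q k h <> E j x.
  (* If every [E j x] were already used, sending [x] to a stage that used it would embed [J] into
     the segment below [j]. *)
  apply: contrapT => H; apply: (ltsmall j).
  have H' x : exists k, exists h : lt k j, q k h = E j x.
    apply: contrapT => nk; apply: H; exists x => k h qk; apply: nk.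
    by exists k, h.
  have [e eP] := choice H'.
  exists e; split; last by move=> x; have [] := eP x.
  move=> x y exy; apply: (Einj j); have [hx <-] := eP x; have [hy <-] := eP y.
  by move: hx; rewrite exy => hx; rewrite (Prop_irrelevance hx hy).
pose next j q := E j (sval (cid (step j q))).
pose p := Fix ltwf (fun _ => T) next.
have pE j : p j = next j (fun k _ => p k).
  apply: (Fix_eq ltwf (fun _ => T) next) => x f g fg; congr next.
  by apply: functional_extensionality_dep => y;
     apply: functional_extensionality_dep => h; apply: fg.
have pne j k : lt k j -> p k <> p j.
  by rewrite (pE j) /next; case: cid => x /= xP; apply: xP.
exists p; split; last by move=> j; eexists; rewrite (pE j).
move=> j k pjk; apply: contrapT => /lttot[] /pne; first exact.
by move=> H; apply: H.
Qed.

(** * Nonvanishing of real polynomials *)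

(** Otherwise the naturals below [size q] would be more roots than the degree allows. *)
Lemma horner_neq0 (R : realType) (q : {poly R}) : q != 0 -> exists x, q.[x] != 0.
Proof.
move=> q0; apply: contrapT => H.
have := @max_poly_roots _ q [seq i%:R | i <- iota 0 (size q)] q0.
rewrite size_map size_iota ltnn => F; suff: false by [].
apply: F.
  apply/allP => x _; apply/negPn/negP => nx; apply: H; exists x.
  exact: nx.
by rewrite map_inj_uniq ?iota_uniq// => i j /eqP; rewrite eqr_nat => /eqP.
Qed.

(** The lowest digit is the residue modulo [d]; cancel it, divide by [d] and induct. This keeps
    distinct monomials distinct under Kronecker substitution. *)
Lemma base_expansion_inj (d n : nat) (a b : 'I_n -> nat) :
  (forall k, (a k < d)%N) -> (forall k, (b k < d)%N) ->
  (\sum_(k < n) a k * d ^ k = \sum_(k < n) b k * d ^ k)%N -> a =1 b.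
Proof.
elim: n a b => [|n IH] a b ad bd; first by move=> _ [].
have shift (c : 'I_n.+1 -> nat) : (\sum_(k < n.+1) c k * d ^ k =
    (\sum_(k < n) c (lift ord0 k) * d ^ k) * d + c ord0)%N.
  rewrite big_ord_recl expn0 muln1 addnC big_distrl /=; congr addn.
  by apply: eq_bigr => k _; rewrite /bump /= add1n expnSr mulnA.
rewrite !shift => e.
have d0 : (0 < d)%N by apply: leq_ltn_trans (ad ord0).
have e0 : a ord0 = b ord0.
  by have := congr1 (modn^~ d) e; rewrite /= !modnMDl !modn_small.
move: e; rewrite e0 => /addIn /eqP; rewrite eqn_pmul2r // => /eqP /IH e1 k.
have [j ->|->//] := unliftP ord0 k.
by apply: e1.
Qed.

(* Kronecker substitution X_k := X^(d^k), with d larger than all exponents. *)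
Lemma meval_neq0 (R : realType) (n : nat) (P : {mpoly R[n]}) :
  P != 0 -> exists v : 'I_n -> R, meval v P != 0.
Proof.
move=> P0; set d := msize P.
pose w (m : 'X_{1..n}) := (\sum_(k < n) m k * d ^ k)%N.
pose q : {poly R} := \sum_(m <- msupp P) (P@_m) *: 'X^(w m).
have qE x : meval (fun k : 'I_n => x ^+ (d ^ k)) P = q.[x].
  rewrite mevalE /q horner_sum; apply: eq_bigr => m _.
  rewrite hornerZ hornerXn; congr (_ * _).
  rewrite /w -prodrXr; apply: eq_bigr => k _.
  by rewrite -exprM mulnC.
suff q0 : q != 0.
  by have [x qx] := horner_neq0 _ _ q0; exists (fun k : 'I_n => x ^+ (d ^ k)); rewrite qE.
have lt_d m : m \in msupp P -> forall k, (m k < d)%N.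
  move=> mP k; apply: leq_ltn_trans (msize_mdeg_lt mP).
  by rewrite mdegE (bigD1 k) //= leq_addr.
have [m0 m0P] : exists m, m \in msupp P.
  move: P0; rewrite -msupp_eq0; case: (msupp P) => // m s _.
  by exists m; rewrite mem_head.
(* Only [m0] contributes to the coefficient of degree [w m0], by uniqueness of base-[d] digits. *)
apply/eqP => /(congr1 (fun r : {poly R} => r`_(w m0))); rewrite coef0 /q coef_sum.
rewrite (bigD1_seq m0) ?msupp_uniq //= coefZ coefXn eqxx mulr1.
rewrite big_seq_cond big1 ?addr0; last first.
  move=> m /andP[mP mm0]; rewrite coefZ coefXn; case: eqP => [e|_]; last by rewrite mulr0.
  exfalso; move/negP: mm0; apply; apply/eqP/mnmP => k.
  have H := base_expansion_inj d n m0 m (lt_d _ m0P) (lt_d _ mP) e.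
  exact/esym/H.
by apply/eqP; rewrite -mcoeff_msupp.
Qed.

(** * Continuum many points in closed sets of positive measure *)

(* Base-4 expansions with digits 0 and 1; the digit sum is at most 4/3. *)
Lemma set_nat_embeds (R : realType) :
  exists f : set nat -> R, injective f /\ forall S, 0 <= f S <= 4 / 3.
Proof.
pose u (S : set nat) n : R := \sum_(k < n) ((k : nat) \in S)%:R * 4^-1 ^+ k.
pose E (S : set nat) := range (u S).
have p4 n : 0 < (4^-1 : R) ^+ n by apply: exprn_gt0; rewrite invr_gt0.
have uS S n : u S n.+1 = u S n + (n \in S)%:R * 4^-1 ^+ n.
  by rewrite /u big_ord_recr.
have b01 (S : set nat) n : 0 <= (n \in S)%:R * (4^-1 : R) ^+ n <= (4^-1 : R) ^+ n.
  by have := p4 n; move=> p; apply/andP; case: (n \in S); rewrite /= ?mulr1n ?mulr0n ?mul1r ?mul0r; split; lra.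
have uD S n d : u S n <= u S (n + d)%N.
  elim: d => [|d IH]; rewrite ?addn0// addnS uS; have := b01 S (n + d)%N; lra.
(* [4 / 3 * 4^-1 ^+ n] is the full tail from [n] on with all digits 1. *)
have vD S n d : u S (n + d)%N + 4 / 3 * 4^-1 ^+ (n + d) <= u S n + 4 / 3 * 4^-1 ^+ n.
  elim: d => [|d IH]; rewrite ?addn0// addnS uS exprS.
  by have := b01 S (n + d)%N; have := p4 (n + d)%N; lra.
have ub S n : ubound (E S) (u S n + 4 / 3 * 4^-1 ^+ n).
  move=> _ [m _ <-]; have [mn|nm] := leP m n.
    have := uD S m (n - m)%N; rewrite subnKC//; have := p4 n; lra.
  have := vD S n (m - n)%N; rewrite subnKC; last exact: ltnW.
  have := p4 m; lra.
have ne S : E S !=set0 by exists (u S 0%N); exists 0%N.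
pose f S := sup (E S).
have fle S n : f S <= u S n + 4 / 3 * 4^-1 ^+ n by apply: ge_sup.
have fge S n : u S n <= f S.
  by apply: ub_le_sup; [exists (u S 0 + 4 / 3 * 4^-1 ^+ 0); apply: ub|exists n].
(* At the first difference [S] gains [4^-n], while everything that [S'] can still add is at most a
   third of that. *)
have key S S' n : (forall k, (k < n)%N -> (k \in S) = (k \in S')) ->
    n \in S -> n \notin S' -> f S' < f S.
  move=> SS' nS nS'.
  have e : u S n = u S' n by apply: eq_bigr => k _; rewrite SS'.
  have := fge S n.+1; have := fle S' n.+1; rewrite !uS nS (negbTE nS') e exprS.
  by have := p4 n; rewrite mul0r mul1r; lra.
exists f; split; last first.
  move=> S; have := fge S 0; have := fle S 0.
  by rewrite /u big_ord0 expr0; lra.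
move=> S S' fSS'; apply: contrapT => ne'.
have [n nP nmin] : exists2 n, (n \in S) != (n \in S') &
    forall k, (k < n)%N -> (k \in S) = (k \in S').
  have ex : exists n, (n \in S) != (n \in S').
    apply: contrapT => H; apply: ne'; apply/seteqP; split => k /mem_set kS;
      apply/set_mem; apply/negPn/negP => nk; apply: H; exists k;
      by rewrite kS (negbTE nk).
  exists (ex_minn ex); first by case: ex_minnP.
  case: ex_minnP => m _ mmin k km; apply/eqP/negPn/negP => /mmin.
  by rewrite leqNgt km.
have [nS|nS] := boolP (n \in S).
  have nS' : n \notin S' by move: nP; rewrite nS; case: (n \in S').
  by have := key S S' n nmin nS nS'; rewrite fSS' ltxx.
have nS' : n \in S' by move: nP; rewrite (negbTE nS); case: (n \in S').
have := key S' S n (fun k kn => esym (nmin k kn)) nS' nS.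
by rewrite fSS' ltxx.
Qed.

(* The point of K at which the measure of K to the left reaches a given value. *)
Lemma interval_embeds_closed (R : realType) (K : set R) :
  closed K -> K `<=` [set x | 0 <= x <= 1] ->
  (0 < @lebesgue_measure R (K : set (measurableTypeR R)))%E ->
  exists m : R, 0 < m /\ exists e : R -> R,
    forall v, 0 < v < m -> K (e v) /\ forall w, 0 < w < m -> e v = e w -> v = w.
Proof.
move=> clK K01 Kpos.
pose mu := @lebesgue_measure R.
have mK : measurable (K : set (measurableTypeR R)).
  exact: measurable_realfun.closed_measurable.
pose Kt t : set (measurableTypeR R) := K `&` `]-oo, t].
have mKt t : measurable (Kt t) by exact: measurableI.
have mu01 : mu `[0, 1]%classic = 1%E.
  by rewrite /mu lebesgue_measure_itv/= lte_fin ltr01 sube0.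
have fin (A : set (measurableTypeR R)) : measurable A -> A `<=` K -> mu A \is a fin_num.
  move=> mA AK; rewrite ge0_fin_numE//.
  apply: (@le_lt_trans _ _ (mu `[0, 1]%classic)); last by rewrite mu01 ltry.
  apply: le_measure; rewrite ?inE//.
  by move=> x /AK /K01 /=; rewrite in_itv.
pose F t := fine (mu (Kt t)).
have FE t : mu (Kt t) = (F t)%:E by rewrite fineK// fin//; exact: subIsetl.
have FB s t : s <= t -> mu (K `&` `]s, t]) = (F t - F s)%:E.
  move=> st.
  have mst : measurable (K `&` `]s, t] : set (measurableTypeR R)) by exact: measurableI.
  have KtE : Kt t = Kt s `|` (K `&` `]s, t]).
    rewrite /Kt -setIUr; congr setI; apply/seteqP; split => x /=.
      rewrite !in_itv/= => xt; case: (leP x s) => ?; [by left|by right].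
    by rewrite !in_itv/= => -[xs|/andP[]//]; apply: le_trans xs st.
  have muE : mu (Kt t) = (mu (Kt s) + mu (K `&` `]s, t]))%E.
    rewrite KtE; apply: measureU => //.
    apply/seteqP; split=> x //= [[_ xs] [_ sx]].
    move: xs sx; rewrite /= !in_itv/= => xs /andP[sx _].
    by have := lt_le_trans sx xs; rewrite ltxx.
  by rewrite EFinB -!FE muE addeAC subee ?add0e// fin//; exact: subIsetl.
have Fmon s t : s <= t -> F s <= F t.
  move=> st; have H : (0 <= mu (K `&` `]s, t]))%E by exact: measure_ge0.
  by move: H; rewrite FB// lee_fin subr_ge0.
have Flip s t : s <= t -> F t - F s <= t - s.
  move=> st; rewrite -lee_fin -FB//.
  apply: (@le_trans _ _ (mu `]s, t]%classic)).
    by apply: le_measure; rewrite ?inE//; first [exact: measurableI|exact: subIsetr].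
  rewrite /mu lebesgue_measure_itv/= lte_fin; case: ltP => // _.
  by rewrite lee_fin subr_ge0.
pose m := F 1.
have m0 : 0 < m.
  have K1 : Kt 1 = K.
    apply/seteqP; split => [x []//|x Kx]; split => //.
    by have /andP[] := K01 _ Kx; rewrite /= in_itv.
  by rewrite -lte_fin -FE K1.
have F0 t : t < 0 -> F t = 0.
  move=> t0; have K0 : Kt t = set0.
    apply/seteqP; split => x //= -[/K01 /= /andP[x0 _]] xt.
    have {}xt : x <= t by move: xt; rewrite in_itv.
    by have := lt_le_trans t0 (le_trans x0 xt); rewrite ltxx.
  by have : mu (Kt t) = 0%E by [rewrite K0; exact: measure0]; rewrite FE => -[].
exists m; split => //.
pose D v := [set t | F t < v].
pose e v := sup (D v).
exists e.
have Dne v : 0 < v -> D v !=set0 by move=> v0; exists (-1); rewrite /D /= F0//; lra.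
have Dub v : v < m -> ubound (D v) 1.
  by move=> vm t /= Dt; rewrite leNgt; apply/negP => /ltW/Fmon; rewrite -/m; move: Dt; rewrite /D/=; lra.
(* As [F] is 1-Lipschitz, [F (e v) > v] would keep [D v] a positive distance below its supremum, and
   [F (e v) < v] would push [D v] past it. *)
have Fe v : 0 < v < m -> F (e v) = v.
  move=> /andP[v0 vm]; apply/eqP; rewrite eq_le; apply/andP; split; rewrite leNgt; apply/negP => H.
    have : e v <= e v - (F (e v) - v).
      apply: ge_sup; first exact: Dne.
      move=> t Dt; rewrite leNgt; apply/negP => tl.
      have te : t <= e v by apply: ub_le_sup => //; exists 1; exact: Dub.
      by have := Flip _ _ te; move: Dt; rewrite /D/=; lra.
    lra.
  have : e v + (v - F (e v)) / 2 <= e v.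
    apply: ub_le_sup; first by exists 1; exact: Dub.
    have := Flip (e v) (e v + (v - F (e v)) / 2); rewrite /D /=; lra.
  lra.
move=> v v01; split; last by move=> w w01 evw; rewrite -(Fe v v01) evw Fe.
(* Off [K], [F] would be constant just to the left of [e v], hence equal to [v] there, although
   [D v] has points arbitrarily close to its supremum. *)
apply: contrapT => nK.
have : nbhs (e v) (~` K) by apply: open_nbhs_nbhs; split=> //; exact: closed_openC.
move=> /nbhs_ballP[r /= r0 rK].
have e0 : mu (K `&` `](e v - r / 2), (e v)]) = 0%E.
  have -> : K `&` `](e v - r / 2), (e v)] = set0; last exact: measure0.
  apply/seteqP; split => x //= -[Kx]; rewrite in_itv/= => /andP[x1 x2].
  apply: (rK x) => //; rewrite /ball/= ger0_norm; lra.
have eF : F (e v - r / 2) = v.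
  have : F (e v) - F (e v - r / 2) = 0 by apply: EFin_inj; rewrite -FB ?e0//; lra.
  by rewrite Fe//; lra.
have [||t Dt] := @sup_gt _ (D v) (e v - r / 2).
- by apply: Dne; case/andP: v01.
- rewrite -/(e v); lra.
by move=> /ltW/Fmon; rewrite eF; move: Dt; rewrite /D /=; lra.
Qed.

(** Closed sets serve as test sets because a countable set of rational balls codes each of them,
    while every non-null Borel subset of [0,1] contains one. *)
Definition positive_closed01 (R : realType) (K : set R) : Prop :=
  [/\ closed K, K `<=` [set x | 0 <= x <= 1] &
      (0 < @lebesgue_measure R (K : set (measurableTypeR R)))%E].

Lemma set_nat_embeds_closed (R : realType) (K : set R) :
  positive_closed01 R K ->
  exists E : set nat -> R, injective E /\ forall S, K (E S).
Proof.
move=> [clK K01 Kpos].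
have [m [m0 [e eP]]] := interval_embeds_closed _ _ clK K01 Kpos.
have [f [finj f01]] := set_nat_embeds R.
(* [(f S + 1) / 3] lies between 1/3 and 7/9, so [g S] avoids both ends of the interval from 0 to
   [m]. *)
pose g S := m * ((f S + 1) / 3).
have gm S : 0 < g S < m.
  have := f01 S => H; apply/andP; split.
    by apply: mulr_gt0 => //; lra.
  by rewrite /g -[ltRHS]mulr1 ltr_pM2l//; lra.
exists (e \o g); split => [S S' /= eSS'|S]; last by have [] := eP _ (gm S).
have [_ /(_ _ (gm S') eSS')] := eP _ (gm S).
move=> /(mulfI (lt0r_neq0 m0)) H; apply: finj; lra.
Qed.

(** * Coding by countable labels and the independent family *)

(** A label [S] both names the set to be met and is the value to be taken there. An injective
    transversal [p] reserves a point for each label, and [G] inverts [p]. *)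
Lemma coded_selector (R : realType) (Q : countType) (Kc : set Q -> set R) :
  exists G : R -> set Q, forall S, positive_closed01 R (Kc S) ->
    exists2 t, Kc S t & G t = S.
Proof.
have pinj : injective (fun S : set Q => pickle @` S).
  move=> S S' SS'; apply/seteqP; split => q Sq.
    have [q' Sq' /(pcan_inj pickleK) <-//] : (pickle @` S') (pickle q).
    by rewrite -SS'; exists q.
  have [q' Sq' /(pcan_inj pickleK) <-//] : (pickle @` S) (pickle q).
  by rewrite SS'; exists q.
(* The recursion needs an embedding for every label, so those with an unsuitable [Kc S] get an
   arbitrary one. *)
have EX S : exists E : set Q -> R, injective E /\
    (positive_closed01 R (Kc S) -> forall S', Kc S (E S')).
  have [KP|nKP] := pselect (positive_closed01 R (Kc S)).
    have [E [Einj EK]] := set_nat_embeds_closed _ _ KP.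
    exists (E \o (fun S : set Q => pickle @` S)).
    by split=> [x y /= /Einj /pinj|_ S']; last exact: EK.
  have [E [Einj _]] := set_nat_embeds R.
  by exists (E \o (fun S : set Q => pickle @` S)); split => // x y /= /Einj /pinj.
have [E EP] := choice EX.
have [p [pI pP]] := injective_transversal _ _ E (fun S => (EP S).1).
exists (fun t => xget set0 [set S | p S = t]) => S KS.
exists (p S); first by have [S' ->] := pP S; apply: (EP S).2.
by apply: pI; apply: (xgetPex set0 (P := [set S' | p S' = p S])); exists S.
Qed.

Lemma sup_ratr (R : realType) (x : R) : sup [set ratr q | q in [set q : rat | ratr q < x]] = x.
Proof.
set A := [set _ | _ in _].
have Aub : ubound A x by move=> _ [q qx <-]; exact: ltW.
have An0 : A !=set0.
  have [|q] := @rat_in_itvoo _ (x - 1) x; first lra.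
  by rewrite in_itv/= => /andP[_ qx]; exists (ratr q), q.
apply/eqP; rewrite eq_le (ge_sup An0 Aub) leNgt; apply/negP => /rat_in_itvoo[q].
rewrite in_itv/= => /andP[Aq qx].
suff : ratr q <= sup A by rewrite leNgt Aq.
by apply: ub_le_sup; [exists x|exists q].
Qed.

(** The open complement of [K] is a union of rational balls, so the balls missing [K] determine
    it. *)
Lemma closed_rat_balls (R : realType) (K : set R) (t : R) : closed K ->
  (forall q r : rat, ball (ratr q : R) (ratr r) `&` K = set0 ->
    ~ ball (ratr q : R) (ratr r) t) -> K t.
Proof.
move=> clK H; apply: contrapT => nKt.
have : nbhs t (~` K) by apply: open_nbhs_nbhs; split=> //; exact: closed_openC.
move=> /nbhs_ballP[e /= e0 eK].
(* With centre within [e / 4] of [t] and radius between [e / 4] and [e / 2], the ball contains [t]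
   and stays within [e] of it. *)
have [|q] := @rat_in_itvoo _ (t - e / 4) t; first lra.
rewrite in_itv/= => /andP[q1 q2].
have [|r] := @rat_in_itvoo _ (e / 4) (e / 2); first lra.
rewrite in_itv/= => /andP[r1 r2].
apply: (H q r); last by rewrite /ball/= ltr_norml; lra.
apply/seteqP; split => // x [+ Kx]; rewrite /ball/= ltr_norml => qx.
by apply: (eK x) => //; rewrite /ball/= ltr_norml; lra.
Qed.

(* Fichtenholz-Kantorovich independence; the value of h A at t depends on the
   trace of A on a finite set of reals coded by G t. *)
Lemma independent_bernstein (R : realType) :
  exists h : set R -> R -> R, forall K, positive_closed01 R K ->
    forall n (A : 'I_n -> set R), injective A -> forall v : 'I_n -> R,
      exists2 t, K t & forall k, h (A k) t = v k.
Proof.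
(* The summands hold, in order: balls missing the closed set, cuts of the test points, cuts of the
   values attached to bit patterns, and the number of test points. *)
pose Q : countType := ((rat * rat) + (nat * rat) + (seq bool * rat) + nat)%type.
pose Kc (S : set Q) : set R := [set t | 0 <= t <= 1 /\
  forall q r, S (inl (inl (inl (q, r)))) -> ~ ball (ratr q : R) (ratr r) t].
pose rl (B : set rat) : R := sup [set ratr q | q in B].
pose pt (S : set Q) i := rl [set q | S (inl (inl (inr (i, q))))].
pose phi (S : set Q) b := rl [set q | S (inl (inr (b, q)))].
pose len (S : set Q) := xget 0%N [set i | S (inr i)].
have [G GP] := @coded_selector R Q Kc.
exists (fun A t => phi (G t) [seq pt (G t) i \in A | i <- iota 0 (len (G t))]).
move=> K KP n A Ainj v.
have sepE (p : 'I_n * 'I_n) : exists x, p.1 <> p.2 -> (x \in A p.1) <> (x \in A p.2).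
  have [->|ne] := eqVneq p.1 p.2; first by exists 0.
  apply: contrapT => H; move/eqP: ne; apply; apply: Ainj.
  apply/seteqP; split => x /mem_set Ax; apply/set_mem; apply: contrapT => nx;
    by apply: H; exists x => _; rewrite Ax => e; apply: nx; first [exact: e|exact: esym e].
have [sep sepP] := choice sepE.
(* One separating point per pair of indices makes the traces of the sets [A k] on [L] pairwise
   distinct. *)
pose L := [seq sep p | p <- enum {: 'I_n * 'I_n}].
pose bits k := [seq x \in A k | x <- L].
have bits_inj : injective bits.
  move=> k l /eq_in_map kl; apply: contrapT => ne.
  by apply: (sepP (k, l) ne); apply: kl; apply: map_f; rewrite mem_enum.
pose val b := if [pick k | bits k == b] is Some k then v k else 0.
(* At a point of [K] carrying this label, [h (A k)] computes the pattern [bits k] and looks up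
   [v k]. *)
pose S : set Q := fun c => match c with
  | inl (inl (inl (q, r))) => ball (ratr q : R) (ratr r) `&` K = set0
  | inl (inl (inr (i, q))) => ratr q < nth 0 L i
  | inl (inr (b, q)) => ratr q < val b
  | inr i => i = size L
  end.
have KS : Kc S = K.
  have [clK K01 _] := KP.
  apply/seteqP; split => t.
    by move=> [_ Ht]; apply: closed_rat_balls.
  move=> Kt; split; first exact: K01.
  move=> q r Sqr qrt; have : (ball (ratr q : R) (ratr r) `&` K) t by split.
  by rewrite Sqr.
have [|t] := GP S; first by rewrite KS.
rewrite KS => Kt Gt; exists t => // k; rewrite Gt.
have -> : len S = size L by apply: (xgetPex 0%N (P := [set i | i = size L])); exists (size L).
have -> : [seq pt S i \in A k | i <- iota 0 (size L)] = bits k.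
  rewrite /bits -[in RHS](mkseq_nth 0 L) -map_comp; apply: eq_map => i /=.
  by rewrite /pt /rl sup_ratr.
rewrite /phi /rl sup_ratr /val; case: pickP => [l /eqP/bits_inj->//|/(_ k)].
by rewrite eqxx.
Qed.

(** * Null sets and Lebesgue measurability *)

Lemma lnull_sub (R : realType) (A B : set R) : A `<=` B -> lnull B -> lnull A.
Proof. by move=> AB [N [mN N0 BN]]; exists N; split=> // x /AB /BN. Qed.

Lemma lnullU (R : realType) (A B : set R) : lnull A -> lnull B -> lnull (A `|` B).
Proof. exact: negligibleU. Qed.

(** Inner regularity with tolerance the measure of [B] itself: the compact set found misses less
    than all of [B], so it is not null. *)
Lemma borel_positive_closed01 (R : realType) (B : set R) :
  measurable (B : set (measurableTypeR R)) -> B `<=` [set x | 0 <= x <= 1] ->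
  (0 < @lebesgue_measure R (B : set (measurableTypeR R)))%E ->
  exists2 K, positive_closed01 R K & K `<=` B.
Proof.
move=> mB B01 Bpos.
have Bfin : (@lebesgue_measure R (B : set (measurableTypeR R)) < +oo)%E.
  apply: (@le_lt_trans _ _ (@lebesgue_measure R `[0%R, 1%R]%classic)).
    by apply: le_measure; rewrite ?inE// => x /B01.
  by rewrite lebesgue_measure_itv/= lte_fin ltr01 sube0 ltry.
pose b := fine (@lebesgue_measure R (B : set (measurableTypeR R))).
have bE : @lebesgue_measure R (B : set (measurableTypeR R)) = b%:E.
  by rewrite fineK// ge0_fin_numE.
have b0 : 0 < b by rewrite -lte_fin -bE.
have [K [cK KB KD]] := @lebesgue_regularity_inner R B b mB Bfin b0.
exists K => //; split; first by apply: compact_closed => //; exact: Rhausdorff.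
  by move=> x /KB /B01.
rewrite lt0e measure_ge0 andbT; apply/eqP => K0.
have mK : measurable (K : set (measurableTypeR R)).
  by apply: measurable_realfun.closed_measurable; apply: compact_closed => //; exact: Rhausdorff.
have muU : (@lebesgue_measure R (B : set (measurableTypeR R)) <=
   @lebesgue_measure R (K : set (measurableTypeR R)) + @lebesgue_measure R (B `\` K : set (measurableTypeR R)))%E.
  have -> : B = K `|` (B `\` K) by rewrite setDUK.
  rewrite [in X in (_ <= _ + X)%E]setDUK//.
  by apply: measureU2 => //; exact: measurableD.
by move: muU; rewrite K0 add0e bE leNgt KD.
Qed.

(** If the level set at [a] were [B] plus a null set, [B] would be null since [u] vanishes somewhere
    on each test set. Then [0,1] minus a Borel null hull of the level set contains a test set, on
    which [u] still takes the value [a]. *)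
Lemma bernstein_nonmeasurable (R : realType) (u : R -> R) (a : R) : a != 0 ->
  (forall K, positive_closed01 R K -> exists2 t, K t & u t = 0) ->
  (forall K, positive_closed01 R K -> exists2 t, K t & u t = a) ->
  ~ lmeasurable_fun (fun t => if `[<0 <= t <= 1>] then u t else 0).
Proof.
move=> a0 u0 ua mu_.
have [B [N [mB [nN E]]]] := mu_ [set a] (measurable_set1 a).
set f := fun t => _ in E.
(* As [a] is nonzero, the extension by 0 outside [0,1] adds nothing to the level set. *)
have EP t : (B `|` N) t -> 0 <= t <= 1 /\ u t = a.
  rewrite -E /f /=; case: asboolP => // _ e0.
  by move: a0; rewrite -e0 eqxx.
have nB : lnull B.
  exists B; split=> //; apply/eqP; rewrite eq_le measure_ge0 andbT leNgt; apply/negP => Bpos.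
  have [|K KP KB] := borel_positive_closed01 _ _ mB _ Bpos.
    by move=> x Bx; apply: (EP x _).1; left.
  have [t Kt ut] := u0 _ KP.
  have [_ uta] := EP t (or_introl (KB _ Kt)).
  by move: a0; rewrite -uta ut eqxx.
have [D [mD muD BND]] := lnullU _ _ _ nB nN.
pose C : set (measurableTypeR R) := `[0%R, 1%R]%classic `\` D.
have mC : measurable C by apply: measurableD.
have CE : `[0%R, 1%R]%classic `<=` C `|` D.
  by move=> x xI; case: (pselect (D x)) => ?; [right|left].
have Cpos : (0 < @lebesgue_measure R C)%E.
  rewrite lt0e measure_ge0 andbT; apply/eqP => C0.
  have : (@lebesgue_measure R `[0%R, 1%R]%classic <= 0)%E.
    apply: (@le_trans _ _ (@lebesgue_measure R (C `|` D))).
      by apply: le_measure; rewrite ?inE//; exact: measurableU.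
    apply: (@le_trans _ _ (@lebesgue_measure R C + @lebesgue_measure R D)%E).
      exact: measureU2.
    by rewrite C0 muD add0e.
  by rewrite lebesgue_measure_itv/= lte_fin ltr01 sube0 lee_fin ler10.
have [|K KP KC] := borel_positive_closed01 _ _ mC _ Cpos.
  by move=> x [/=]; rewrite in_itv.
have [t Kt ut] := ua _ KP.
have [tI nDt] := KC _ Kt; apply: nDt; apply: BND; rewrite -E /f /=.
by case: asboolP => // nt; exfalso; apply: nt; move: tI; rewrite /= in_itv.
Qed.

(** A preimage is null if [B] omits 0; otherwise it contains the complement of a Borel null hull of
    [M], which serves as its Borel part. *)
Lemma lmeasurable_fun_lnull_support (R : realType) (f : R -> R) (M : set R) :
  lnull M -> (forall t, f t != 0 -> M t) -> lmeasurable_fun f.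
Proof.
move=> nM fM B mB.
have [B0|nB0] := pselect (B 0); last first.
  exists set0, (f @^-1` B); split; first exact: measurable0.
  split; last by rewrite set0U.
  apply: lnull_sub nM => t /= Bft; apply: fM; apply/eqP => ft.
  by apply: nB0; rewrite -ft.
have [N [mN N0 MN]] := nM.
exists (~` N), (f @^-1` B `&` N); split; first exact: measurableC.
split; first by exists N; split=> // t [].
apply/seteqP; split=> t.
  by move=> Bft; have [Nt|nNt] := pselect (N t); [right|left].
case=> [nNt|[]//]; rewrite /preimage /=.
have [->//|/eqP ft] := pselect (f t = 0).
by exfalso; apply: nNt; apply: MN; apply: fM.
Qed.

Lemma positive_closed01_itv (R : realType) : positive_closed01 R `[0%R, 1%R]%classic.
Proof.
split; first exact: interval_closed.
  by move=> x; rewrite /= in_itv.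
by rewrite lebesgue_measure_itv/= lte_fin ltr01 sube0 lte_fin ltr01.
Qed.

(** * The generators and their algebra *)

(* The cover exhausts [0,1] along null sets, so the truncations of any function
   vanish almost everywhere yet are eventually constant at each point. *)
Theorem mainTheorem18 (R : realType) (I : Type) (lt : I -> I -> Prop) :
  @is_addN_ordinal R I lt ->
  (* add(N) = cov(N) *)
  @covers01 R I ->
  (* AN_{add(N)} is strongly 2^c-algebrable *)
  @strongly_algebrable R I (set R) [set: set R] (@AN R I lt).
Proof.
move=> [_ small notsmall] [F [nF Fcov]].
have [h hP] := independent_bernstein R.
(* [M j] contains every [F i] with [i] before [j], and stays null since proper initial segments lie
   below add(N). *)
pose M i := F i `|` \bigcup_(j in [set j | lt j i]) F j.
have nM i : lnull (M i) by apply: lnullU => //; apply: small.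
pose D i := [set t : R | 0 <= t <= 1 /\ M i t].
have nD i : lnull (D i) by apply: lnull_sub (nM i) => t [].
pose f (A : set R) (i : I) (t : R) := if `[<D i t>] then h A t else 0.
have fin A i t : D i t -> f A i t = h A t by rewrite /f; case: asboolP.
have fout A i t : ~ D i t -> f A i t = 0 by rewrite /f; case: asboolP.
have Dex t : 0 <= t <= 1 -> exists i, D i t.
  by move=> t01; have [i _ Fit] := Fcov t t01; exists i; split=> //; left.
have P01 := positive_closed01_itv R.
have itv01 t : `[0%R, 1%R]%classic t -> 0 <= t <= 1 by rewrite /= in_itv.
exists (range f); split.
  apply: inj_card_eq => A B _ _ fAB; apply: contrapT => AB.
  (* Independence for the pair [A], [B] with values 1 and 0 separates [f A] from [f B], so the
     generators are as many as the sets of reals. *)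
  pose c (k : 'I_2) := if k == ord0 then A else B.
  have cinj : injective c.
    move=> [[|[|//]] k2] [[|[|//]] l2]; rewrite /c /= => e;
      first [exact: val_inj|by case: (AB e)|by case: (AB (esym e))].
  have [t /itv01 t01 tP] := hP _ P01 _ c cinj (fun k => if k == ord0 then 1 else 0).
  have [i Dit] := Dex t t01.
  have := congr1 (fun g => g i t) fAB; rewrite /= !fin//.
  have := tP ord0; have := tP ord_max; rewrite /c /= => -> -> /eqP.
  by rewrite oner_eq0.
move=> n x xinj Xx P P0.
have Aex k : exists A, f A = x k by have [A _ fA] := Xx k; exists A.
have [A AP] := choice Aex.
have Ainj : injective A by move=> k l Akl; apply: xinj; rewrite -!AP Akl.
pose u t := meval (fun k => h (A k) t) P.
have pin i t : D i t -> peval P x i t = u t.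
  by move=> Dit; apply: meval_eq => k; rewrite -AP fin.
have pout i t : ~ D i t -> peval P x i t = meval (fun _ => 0) P.
  by move=> Dit; apply: meval_eq => k; rewrite -AP fout.
have [v vP] := meval_neq0 _ _ _ P0.
have uval K w : positive_closed01 R K -> exists2 t, K t & u t = meval w P.
  move=> KP; have [t Kt tw] := hP K KP n A Ainj w.
  by exists t => //; apply: meval_eq.
split.
  move=> p0; have [t /itv01 t01 ut] := uval _ v P01.
  have [i Dit] := Dex t t01.
  by move: vP; rewrite -ut -(pin i)// p0 eqxx.
move=> Pz; split.
  move=> i; apply: (lmeasurable_fun_lnull_support _ _ _ (nD i)) => t.
  move=> ft; have [//|nDt] := pselect (D i t).
  by move: ft; rewrite pout// Pz eqxx.
exists (fun t => if `[<0 <= t <= 1>] then u t else 0); split.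
  (* On each test set [u] takes both the value of [P] at the origin, which is 0, and its nonzero
     value at [v]. *)
  apply: (bernstein_nonmeasurable _ _ _ vP) => K KP; last exact: uval.
  by rewrite -Pz; exact: uval.
exists set0; split.
  by exists set0; split=> //; exact: measure0.
move=> t _ U Ut; case: asboolP Ut => t01 Ut; last first.
  (* Outside [0,1] all terms vanish, but convergence still asks for an index: take one whose null
     set covers 0. *)
  have [i _] : exists i : I, True.
    by have [|i _ _] := Fcov 0; [rewrite /= lexx ler01|exists i].
  exists i => j _; rewrite pout ?Pz; first exact: nbhs_singleton.
  by case.
have [i _ Fit] := Fcov t t01.
(* Beyond an [i] with [t] in [F i], the truncation no longer affects [t]. *)
exists i => j ij; rewrite pin; first exact: nbhs_singleton.
by split=> //; right; exists i.
Qed.
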